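(* Let $n, c \ge 1$, $d_1,\dots,d_c \ge 1$ and $k \ge 0$ be integers with $n-c \ge 2$, and let $(X,D)$ be a generic smooth complete intersection pair in $\mathbb{P}^n$ of type $(d_1,\dots,d_c;k)$. If the total degree satisfies $d = d_1+\cdots+d_c+k \ge 2n-c$, then the interior $X\setminus D$ contains no $\mathbb{A}^1$-curves.
   Context: All varieties are over $\mathbb{C}$. A smooth complete intersection pair of type $(d_1,\dots,d_c;k)$ in $\mathbb{P}^n$ is a pair $(X,D)$ where $X\subset\mathbb{P}^n$ is a complete intersection of hypersurfaces of degrees $d_1,\dots,d_c$, $D\subset X$ is the intersection of $X$ with a hypersurface of degree $k$, and both $X$ and $D$ are smooth; when $k=0$ the boundary $D$ is empty. Its total degree is $d=d_1+\cdots+d_c+k$. Such pairs are parametrized by the open subset $S^\circ$ of smooth pairs in $S=\prod_{i=1}^{c+1}H^0(\mathcal{O}_{\mathbb{P}^n}(d_i))$ (with $d_{c+1}=k$); ''generic'' means the pair corresponds to a point of $S^\circ$ outside a countable union of proper Zariski-closed subsets. An $\mathbb{A}^1$-curve on the interior $X\setminus D$ is a non-constant morphism $\mathbb{A}^1\to X\setminus D$. *)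

(* Defs.v *)
From HB Require Import structures.
From mathcomp Require Import all_boot all_order all_algebra.
From Stdlib Require Rdefinitions.
Set Implicit Arguments. Unset Strict Implicit. Unset Printing Implicit Defensive.
Import Order.TTheory GRing.Theory Num.Theory.
Local Open Scope ring_scope.

Definition Reals := Rdefinitions.R.

(* A field C "is the complex numbers" (up to field isomorphism, by Steinitz):
   algebraically closed, characteristic 0, cardinality of the continuum. *)
Definition is_complex_field (C : closedFieldType) : Prop :=
  [pchar C] =i pred0 /\ exists f : C -> Reals, bijective f.

Definition mon (N d : nat) :=
  {m : N.-tuple 'I_d.+1 | (\sum_(i < N) (tnth m i : nat))%N == d}.
Arguments mon : clear implicits.

Definition expo (N d : nat) (m : mon N d) (j : 'I_N) : nat := tnth (val m) j.

(* A homogeneous form of degree d in N variables = its coefficient vector,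
   i.e. an element of H^0(P^{N-1}, O(d)). *)
Definition hform (C : Type) (N d : nat) := mon N d -> C.
Arguments hform : clear implicits.

Definition eval_form (C : fieldType) (N d : nat) (F : hform C N d) (x : 'I_N -> C) : C :=
  \sum_(m : mon N d) F m * \prod_(j < N) x j ^+ expo m j.

Definition deriv_form (C : fieldType) (N d : nat) (F : hform C N d) (j : 'I_N)
    (x : 'I_N -> C) : C :=
  \sum_(m : mon N d) F m * (expo m j)%:R * x j ^+ (expo m j).-1
                     * \prod_(l < N | l != j) x l ^+ expo m l.

Definition nonzero_pt (C : fieldType) (N : nat) (x : 'I_N -> C) : Prop :=
  exists j, x j != 0.

Definition jacX (C : fieldType) (n c : nat) (d : 'I_c -> nat)
    (F : forall i : 'I_c, hform C n.+1 (d i)) (x : 'I_n.+1 -> C) : 'M[C]_(c, n.+1) :=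
  \matrix_(i < c, j < n.+1) deriv_form (F i) j x.

Definition jacD (C : fieldType) (n c : nat) (d : 'I_c -> nat) (k : nat)
    (F : forall i : 'I_c, hform C n.+1 (d i)) (G : hform C n.+1 k) (x : 'I_n.+1 -> C)
    : 'M[C]_(c + 1, n.+1) :=
  col_mx (jacX F x) (\row_(j < n.+1) deriv_form G j x).

Definition onX (C : fieldType) (n c : nat) (d : 'I_c -> nat)
    (F : forall i : 'I_c, hform C n.+1 (d i)) (x : 'I_n.+1 -> C) : Prop :=
  nonzero_pt x /\ forall i, eval_form (F i) x = 0.

(* (X, D) is a smooth complete intersection pair (Jacobian criterion):
   X = V(F_1..F_c) is smooth of codimension c, D = X ∩ V(G) is smooth of
   codimension c+1 (for k = 0 and G a nonzero constant, D is empty). *)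
Definition smooth_pair (C : fieldType) (n c : nat) (d : 'I_c -> nat) (k : nat)
    (F : forall i : 'I_c, hform C n.+1 (d i)) (G : hform C n.+1 k) : Prop :=
  (forall x, onX F x -> \rank (jacX F x) = c) /\
  (forall x, onX F x -> eval_form G x = 0 -> \rank (jacD F G x) = (c + 1)%N).

(* An A^1-curve on X \ D: a non-constant morphism A^1 -> P^n, given by
   polynomials f_0..f_n without common zero, with image in X and missing D. *)
Definition A1_curve (C : fieldType) (n c : nat) (d : 'I_c -> nat) (k : nat)
    (F : forall i : 'I_c, hform C n.+1 (d i)) (G : hform C n.+1 k)
    (f : 'I_n.+1 -> {poly C}) : Prop :=
  (forall t : C, exists j, (f j).[t] != 0) /\
  (forall t : C, forall i, eval_form (F i) (fun j => (f j).[t]) = 0) /\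
  (forall t : C, eval_form G (fun j => (f j).[t]) != 0) /\
  (exists t1 t2 : C, exists i j,
      (f i).[t1] * (f j).[t2] != (f j).[t1] * (f i).[t2]).

(* The parameter space S = prod_i H^0(O(d_i)) x H^0(O(k)) as an affine
   space with coordinates indexed by the finite type S_index. *)
Definition S_index (n c : nat) (d : 'I_c -> nat) (k : nat) :=
  ({i : 'I_c & mon n.+1 (d i)} + mon n.+1 k)%type.
Arguments S_index : clear implicits.

Definition S_coords (C : fieldType) (n c : nat) (d : 'I_c -> nat) (k : nat)
    (F : forall i : 'I_c, hform C n.+1 (d i)) (G : hform C n.+1 k)
    : S_index n c d k -> C :=
  fun a => match a with
           | inl p => F (tag p) (tagged p)
           | inr m => G m
           end.

(* Polynomial functions on an affine space with coordinates indexed by a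
   finite type I: finite lists of terms (coefficient, exponent vector). *)
Definition mpoly (C : Type) (I : Type) := seq (C * (I -> nat)).
Arguments mpoly : clear implicits.

Definition mpoly_eval (C : fieldType) (I : finType) (P : mpoly C I) (s : I -> C) : C :=
  \sum_(p <- P) p.1 * \prod_(i : I) s i ^+ p.2 i.

Definition in_zero_locus (C : fieldType) (I : finType) (Z : mpoly C I -> Prop)
    (s : I -> C) : Prop :=
  forall P, Z P -> mpoly_eval P s = 0.

Definition proper_closed (C : fieldType) (I : finType) (Z : mpoly C I -> Prop) : Prop :=
  exists s, ~ in_zero_locus Z s.

(* Main.v *)
Require Import Defs.
From HB Require Import structures.
From mathcomp Require Import all_boot all_order all_algebra.
From mathcomp Require Import ring zify.
From Stdlib Require Import Classical_Prop.
Set Implicit Arguments. Unset Strict Implicit. Unset Printing Implicit Defensive.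
Import GRing.Theory.
Local Open Scope ring_scope.

(** A very general pair has coefficients algebraically independent over Q, so for
    every coefficient there is a partial derivation of C with value 1 on it and 0 on
    the others.  Applying it to the coefficients of the identities F_i(f) = 0 and
    G(f) = const (a polynomial without zeros is constant) shows that f deforms to
    first order, with deformation vectors w_m of degree <= e = deg f, along each
    monomial direction m of the parameter space.  The combinations
    f_b w_m - f_l w_(m x_b / x_l) have degree <= 2e and are killed by the Jacobian J
    of the equations along f; as in the work of Clemens, Ein and Voisin, fields of
    this degree span the kernel of J at any given point.  Complete f' (and also f,
    when k = 0) by such fields to a basis W of ker J at one point.  As J has full
    rank everywhere, infinity included, the maximal minors of W are those of J times
    a fixed nonzero polynomial.  For k > 0 this gives
    (d - c - 1) e <= (e - 1) + (n - c - 1) 2e, and for k = 0 it gives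
    (d - c) e <= e + (e - 1) + (n - c - 1) 2e; both contradict d >= 2n - c. *)

(** * Partial derivations *)

Section PartialDerivations.
Variable C : fieldType.

(* [B x y] reads: the derivation is defined at [x], with value [y]. *)
Record partial_derivation (B : C -> C -> Prop) : Prop := PartialDerivation {
  pder1 : B 1 0;
  pderN1 : B (-1) 0;
  pderD : forall x y x' y', B x y -> B x' y' -> B (x + x') (y + y');
  pderM : forall x y x' y', B x y -> B x' y' -> B (x * x') (x * y' + y * x');
  pder_uniq0 : forall y, B 0 y -> y = 0 }.

Definition pder_poly (B : C -> C -> Prop) (p q : {poly C}) : Prop :=
  forall i, B p`_i q`_i.

Section Closure.
Variables (B : C -> C -> Prop) (hB : partial_derivation B).

Lemma pder0 : B 0 0.
Proof.
by have := pderD hB (pder1 hB) (pderN1 hB); rewrite subrr addr0.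
Qed.

Lemma pderN x y : B x y -> B (- x) (- y).
Proof.
by move=> h; have := pderM hB (pderN1 hB) h; rewrite !mulN1r mul0r addr0.
Qed.

Lemma pder_sum (I : Type) (r : seq I) (P : pred I) (F G : I -> C) :
  (forall i, B (F i) (G i)) ->
  B (\sum_(i <- r | P i) F i) (\sum_(i <- r | P i) G i).
Proof.
move=> h; apply: (big_ind2 B) => //; first exact: pder0.
by move=> x y x' y' ? ?; apply: (pderD hB).
Qed.

Lemma pder_mulrn x y n : B x y -> B (x *+ n) (y *+ n).
Proof.
move=> h; elim: n => [|n IH]; first by rewrite !mulr0n; apply: pder0.
by rewrite !mulrS; apply: (pderD hB).
Qed.

Lemma pder_polyC x y : B x y -> pder_poly B x%:P y%:P.
Proof. by move=> h i; rewrite !coefC; case: eqP => // _; apply: pder0. Qed.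

Lemma pder_polyD p q p' q' :
  pder_poly B p q -> pder_poly B p' q' -> pder_poly B (p + p') (q + q').
Proof. by move=> h h' i; rewrite !coefD; apply: (pderD hB). Qed.

Lemma pder_polyM p q p' q' :
  pder_poly B p q -> pder_poly B p' q' ->
  pder_poly B (p * p') (p * q' + q * p').
Proof.
move=> h h' i; rewrite coefD !coefM -big_split /=.
by apply: pder_sum => j; apply: (pderM hB).
Qed.

Lemma pder_polyXn n : pder_poly B 'X^n 0.
Proof.
move=> i; rewrite coefXn coef0; case: eqP => _; [exact: (pder1 hB) | exact: pder0].
Qed.

Lemma pder_poly_deriv p q : pder_poly B p q -> pder_poly B p^`() q^`().
Proof. by move=> h i; rewrite !coef_deriv; apply: pder_mulrn. Qed.

Lemma pder_poly0 q : pder_poly B 0 q -> q = 0.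
Proof.
move=> h; apply/polyP => i; rewrite coef0; apply: (pder_uniq0 hB).
by have := h i; rewrite coef0.
Qed.

End Closure.

Hypothesis char0 : forall n, (n%:R == 0 :> C) = (n == 0%N).

Lemma deriv_eq0 (p : {poly C}) : p^`() = 0 -> p = (p`_0)%:P.
Proof.
move=> h; apply/polyP => -[|i]; rewrite coefC //=.
move: (congr1 (fun q : {poly C} => q`_i) h); rewrite coef_deriv coef0 -mulr_natr.
by move/eqP; rewrite mulf_eq0 char0 orbF => /eqP.
Qed.

(* The only constraint on the value [y] of the derivation at [x] comes from the
   polynomial of least degree killing [x], whose derivative does not kill [x]. *)
Lemma pder_compatible_value (B : C -> C -> Prop) (hB : partial_derivation B) (x : C) :
  exists y, forall p q, pder_poly B p q -> p.[x] = 0 ->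
    q.[x] + p^`().[x] * y = 0.
Proof.
(* If no nonzero polynomial over the domain of [B] kills [x], any value is compatible, and 0 is
   taken. *)
case: (classic (exists p q, [/\ pder_poly B p q, p.[x] = 0 & p != 0])) => [ex|nex]; last first.
  exists 0 => p q hpq px; have [p0|p0] := eqVneq p 0; last by case: nex; exists p, q.
  by rewrite p0 in hpq; rewrite (pder_poly0 hB hpq) horner0 mulr0 addr0.
have [p [q [hpq px p0 hmin]]] : exists p q, [/\ pder_poly B p q, p.[x] = 0, p != 0 &
    forall p' q', pder_poly B p' q' -> p'.[x] = 0 -> (size p' < size p)%N -> p' = 0].
  case: ex => p [q []]; move: {2}(size p) (leqnn (size p)) => n.
  elim: n p q => [|n IH] p q hs hpq px p0.
    by move: hs p0; rewrite leqn0 size_poly_eq0 => ->.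
  case: (classic (exists p' q', [/\ pder_poly B p' q', p'.[x] = 0,
      (size p' < size p)%N & p' != 0])) => [[p' [q' [h1 h2 h3 h4]]]|h].
    by apply: (IH p' q') => //; rewrite -ltnS (leq_trans h3).
  exists p, q; split => // p' q' h1 h2 h3.
  by have [//|h4] := eqVneq p' 0; case: h; exists p', q'.
have p'x : p^`().[x] != 0.
  apply/eqP => h; have /deriv_eq0 pC : p^`() = 0.
    by apply: hmin h _; [exact: (pder_poly_deriv hB hpq) | exact: lt_size_deriv].
  by move: px p0; rewrite pC hornerC => ->; rewrite polyC0 eqxx.
exists (- q.[x] / p^`().[x]).
have hp : q.[x] + p^`().[x] * (- q.[x] / p^`().[x]) = 0 by field.
move: (_ / _) hp => y hp P Q.
move: {2}(size P) (leqnn (size P)) => n.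
elim: n P Q => [|n IH] P Q hs hPQ Px.
  move: hs hPQ; rewrite leqn0 size_poly_eq0 => /eqP-> /(pder_poly0 hB)->.
  by rewrite horner0 deriv0 horner0 mul0r addr0.
have [hlt|hge] := ltnP (size P) (size p).
  have P0 := hmin _ _ hPQ Px hlt; rewrite P0 in hPQ *.
  rewrite (pder_poly0 hB hPQ).
  by rewrite horner0 deriv0 horner0 mul0r addr0.
(* One step of pseudo-division: [lp * P - lP * X^k * p] is shorter than [P] and still kills [x].
   Leading coefficients are not inverted because the domain of [B] is only a ring. *)
set k := (size P - size p)%N.
set lp := p`_(size p).-1; set lP := P`_(size P).-1.
set dlp := q`_(size p).-1; set dlP := Q`_(size P).-1.
have h1 := pder_polyM hB (pder_polyC hB (hpq (size p).-1)) hPQ.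
have h2 := pder_polyM hB (pder_polyC hB (pderN hB (hPQ (size P).-1)))
  (pder_polyM hB (pder_polyXn hB k) hpq).
have h3 := pder_polyD hB h1 h2.
have lp0 : lp != 0 by rewrite /lp -lead_coefE lead_coef_eq0.
have := IH _ _ _ h3.
rewrite -/lp -/lP -/dlp -/dlP => H.
have /H {H} : (size (lp%:P * P + (- lP)%:P * ('X^k * p))%R <= n)%N.
  have sP : (0 < size P)%N by rewrite (leq_trans _ hge) // lt0n size_poly_eq0.
  rewrite -ltnS (leq_trans _ hs) // -(prednK sP) ltnS.
  apply/leq_sizeP => j hj; rewrite coefD !coefCM coefXnM mulNr.
  have sp : (0 < size p)%N by rewrite lt0n size_poly_eq0.
  case: ltnP => hjk; first by rewrite /k in hjk; lia.
  have [->|hj'] := eqVneq j (size P).-1.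
    rewrite (_ : ((size P).-1 - k = (size p).-1)%N); last by rewrite /k; lia.
    by rewrite -/lp -/lP mulrC subrr.
  rewrite (nth_default _ (_ : size P <= j)%N); last by lia.
  by rewrite (nth_default _ (_ : size p <= j - k)%N) ?mulr0 ?subrr // /k; lia.
rewrite !(derivD, derivM, derivC, derivXn, hornerE, mul0r) /= px Px.
rewrite !(mulr0, addr0, mul0r, add0r) => /(_ erefl) H.
have /eqP : lp * (Q.[x] + P^`().[x] * y) = 0.
  transitivity (lP * x ^+ k * (q.[x] + p^`().[x] * y)); last by rewrite hp mulr0.
  by apply/eqP; rewrite -subr_eq0 -[X in _ == X]H; apply/eqP; ring.
by rewrite mulf_eq0 (negPf lp0) /= => /eqP.
Qed.

(** The extension to polynomial expressions in [x] is dictated by the product rule once the value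
    [y] at [x] is chosen. Its uniqueness at 0 is exactly the compatibility of [y]. *)
Lemma pder_adjoin (B : C -> C -> Prop) (x : C) :
  partial_derivation B ->
  exists B', [/\ partial_derivation B', forall z w, B z w -> B' z w &
    exists y, B' x y].
Proof.
move=> hB; have [y hy] := pder_compatible_value hB x.
exists (fun z w => exists p q, [/\ pder_poly B p q, z = p.[x] &
   w = q.[x] + p^`().[x] * y]).
have sub z w : B z w -> exists p q, [/\ pder_poly B p q, z = p.[x] &
   w = q.[x] + p^`().[x] * y].
  move=> h; exists z%:P, w%:P; rewrite derivC !hornerC mul0r addr0.
  by split=> //; apply: pder_polyC.
split=> //; last first.
  exists y, 'X, 0; rewrite derivX !hornerE; split=> //.
  exact: (pder_polyXn hB 1).
split.
- exact: (sub _ _ (pder1 hB)).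
- exact: (sub _ _ (pderN1 hB)).
- move=> _ _ _ _ [p [q [h -> ->]]] [p' [q' [h' -> ->]]].
  exists (p + p'), (q + q'); split; first exact: pder_polyD.
    by rewrite hornerD.
  by rewrite derivD !hornerD; ring.
- move=> _ _ _ _ [p [q [h -> ->]]] [p' [q' [h' -> ->]]].
  exists (p * p'), (p * q' + q * p'); split; first exact: pder_polyM.
    by rewrite hornerM.
  by rewrite derivM !(hornerD, hornerM); ring.
- by move=> _ [p [q [h h0 ->]]]; apply: hy.
Qed.

(** A curve has finitely many coefficients, so finitely many adjunctions reach all of them and the
    derivation stays partial. *)
Lemma pder_adjoin_seq (xs : seq C) (B : C -> C -> Prop) :
  partial_derivation B ->
  exists B', [/\ partial_derivation B', forall z w, B z w -> B' z w &
    forall x, x \in xs -> exists y, B' x y].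
Proof.
elim: xs B => [|x xs IH] B hB; first by exists B; split.
have [B1 [hB1 s1 [y hy]]] := pder_adjoin x hB.
have [B2 [hB2 s2 h2]] := IH _ hB1.
exists B2; split=> // [z w /s1 /s2 //|z]; rewrite inE => /orP[/eqP->|/h2 //].
by exists y; apply: s2.
Qed.

Lemma poly_fun0 (p : {poly C}) : (forall x, p.[x] = 0) -> p = 0.
Proof.
move=> h; apply/eqP/negP => /negP p0.
pose rs := [seq i%:R : C | i <- iota 0 (size p)].
have hall : all (root p) rs by apply/allP => z _; apply/rootP.
suff hu : uniq rs by have := max_poly_roots p0 hall hu; rewrite size_map size_iota ltnn.
rewrite map_inj_uniq ?iota_uniq // => i j.
wlog le_ij : i j / (i <= j)%N.
  by move=> H; move=> e; case: (leqP i j) => [/H|/ltnW /H h']; [exact | rewrite h'].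
move/esym/eqP; rewrite -subr_eq0 -natrB // char0 subn_eq0 => le_ji.
by apply/eqP; rewrite eqn_leq le_ij.
Qed.

(** * Partial derivatives at an algebraically independent point *)

Section AlgebraicallyIndependent.
Variables (I : finType) (s : I -> C).

(** Integer coefficients and finite functions as exponents make this a countable type, to be
    enumerated by [unpickle]. *)
Definition int_mpoly := seq (int * {ffun I -> nat}).

Definition of_int_mpoly (P : int_mpoly) : Defs.mpoly C I :=
  [seq (p.1%:~R, (p.2 : I -> nat)) | p : int * {ffun I -> nat} <- P].

(** Algebraic independence over Q. A list of terms may represent the zero polynomial in many ways,
    so being zero is expressed as vanishing at every point. *)
Definition alg_independent :=
  forall P : int_mpoly, mpoly_eval (of_int_mpoly P) s = 0 ->
    forall s', mpoly_eval (of_int_mpoly P) s' = 0.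

Variable a : I.

(** The derivative of this polynomial at [s a] is the partial derivative of [P] in direction [a] at
    [s]. *)
Definition partial_eval (P : int_mpoly) : {poly C} :=
  \sum_(p <- P) (p.1%:~R * \prod_(i | i != a) s i ^+ p.2 i) *: 'X^(p.2 a).

Lemma partial_evalE P x :
  (partial_eval P).[x] =
  mpoly_eval (of_int_mpoly P) (fun i => if i == a then x else s i).
Proof.
rewrite /mpoly_eval /of_int_mpoly big_map /partial_eval horner_sum.
apply: eq_bigr => p _; rewrite hornerZ hornerXn /= -mulrA; congr (_ * _).
rewrite [RHS](bigD1 a) //= eqxx mulrC; congr (_ * _).
by apply: eq_bigr => i /negPf->.
Qed.

Lemma partial_eval_cat P P' :
  partial_eval (P ++ P') = partial_eval P + partial_eval P'.
Proof. by rewrite /partial_eval big_cat. Qed.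

Definition int_mpoly_mul (P P' : int_mpoly) : int_mpoly :=
  allpairs (fun p p' : int * {ffun I -> nat} =>
    (p.1 * p'.1, [ffun i => p.2 i + p'.2 i]%N)) P P'.

Lemma partial_eval_mul P P' :
  partial_eval (int_mpoly_mul P P') = partial_eval P * partial_eval P'.
Proof.
rewrite /partial_eval /int_mpoly_mul big_allpairs_dep /= mulr_suml; apply: eq_bigr => p _.
rewrite mulr_sumr; apply: eq_bigr => p' _; rewrite ffunE exprD.
rewrite -scalerAl -scalerAr scalerA; congr (_ *: _).
rewrite rmorphM /= -!mulrA; congr (_ * _).
rewrite [RHS]mulrCA; congr (_ * _); rewrite -big_split.
by apply: eq_bigr => i _; rewrite ffunE exprD.
Qed.

Lemma partial_eval_mono z (g : {ffun I -> nat}) :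
  partial_eval [:: (z, g)] = (z%:~R * \prod_(i | i != a) s i ^+ g i) *: 'X^(g a).
Proof. by rewrite /partial_eval big_seq1. Qed.

(** The derivation is the partial derivative in direction [a] on the ring Z[s]. It is well defined
    because an integer polynomial vanishing at [s] vanishes identically, and so does its partial
    evaluation. *)
Lemma alg_independent_pder : alg_independent ->
  exists B, partial_derivation B /\ forall b, B (s b) (b == a)%:R.
Proof.
move=> hs; exists (fun z w => exists P, z = (partial_eval P).[s a] /\
  w = (partial_eval P)^`().[s a]); split; last first.
  move=> b; exists [:: (1, [ffun i => (i == b) : nat])].
  rewrite partial_eval_mono ffunE mul1r eq_sym.
  have [->|hab] := eqVneq a b.
    rewrite big1 => [|i]; last by rewrite ffunE => /negPf->; rewrite expr0.
    by rewrite scale1r derivX !hornerE.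
  rewrite (bigD1 b) 1?eq_sym //= big1 => [|i /andP[_]]; last first.
    by rewrite ffunE => /negPf->; rewrite expr0.
  by rewrite ffunE eqxx derivZ derivC !hornerE.
have const z : exists P, z%:~R = (partial_eval P).[s a] /\
    0 = (partial_eval P)^`().[s a].
  exists [:: (z, [ffun=> 0%N])]; rewrite partial_eval_mono ffunE.
  rewrite big1 => [|i _]; last by rewrite ffunE expr0.
  by rewrite derivZ derivC !hornerE.
split.
- exact: (const 1).
- exact: (const (-1)).
- move=> _ _ _ _ [P [-> ->]] [P' [-> ->]]; exists (P ++ P').
  by rewrite partial_eval_cat derivD !hornerD.
- move=> _ _ _ _ [P [-> ->]] [P' [-> ->]].
  exists (int_mpoly_mul P P'); rewrite partial_eval_mul derivM !(hornerD, hornerM); split=> //.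
  by rewrite addrC.
- move=> _ [P [h ->]]; rewrite (_ : partial_eval P = 0) ?deriv0 ?horner0 //.
  apply: poly_fun0 => x; rewrite partial_evalE; apply: hs.
  rewrite [RHS]h partial_evalE; apply: eq_bigr => p _; congr (_ * _).
  by apply: eq_bigr => i _; case: eqP => // ->.
Qed.

End AlgebraicallyIndependent.
End PartialDerivations.

(** * Degrees of kernels of polynomial matrices *)

Section DegreeBound.
Variable C : closedFieldType.

(** A polynomial of degree at most [a] is a section of O(a) on the projective line, and [c],
    possibly 0, is its value at infinity. *)
Definition top_coef (p : {poly C}) (a : nat) (c : C) : Prop :=
  (size p <= a.+1)%N /\ p`_a = c.

Lemma top_coefD p q a c c' :
  top_coef p a c -> top_coef q a c' -> top_coef (p + q) a (c + c').
Proof.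
move=> [h1 <-] [h2 <-]; split; last by rewrite coefD.
by rewrite (leq_trans (size_polyD _ _)) // geq_max h1.
Qed.

Lemma top_coef0 a : top_coef 0 a 0.
Proof. by rewrite /top_coef size_poly0 coef0. Qed.

Lemma top_coefZ p a c k : top_coef p a c -> top_coef (k *: p) a (k * c).
Proof.
move=> [h <-]; split; last by rewrite coefZ.
exact: leq_trans (size_scale_leq _ _) h.
Qed.

Lemma top_coef_sum (I : Type) (r : seq I) (P : pred I) (F : I -> {poly C}) G a :
  (forall i, P i -> top_coef (F i) a (G i)) ->
  top_coef (\sum_(i <- r | P i) F i) a (\sum_(i <- r | P i) G i).
Proof.
move=> h; apply: (big_ind2 (fun p c => top_coef p a c)) => //.
  exact: top_coef0.
by move=> p c q c'; apply: top_coefD.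
Qed.

Lemma top_coef1 : top_coef 1 0 1.
Proof. by rewrite /top_coef size_poly1 coef1. Qed.

Lemma top_coefM p q a b c c' :
  top_coef p a c -> top_coef q b c' -> top_coef (p * q) (a + b) (c * c').
Proof.
move=> [h1 <-] [h2 <-]; split.
  by rewrite (leq_trans (size_polyMleq _ _)) //; move: h1 h2; lia.
rewrite coefM.
have ha : (a < (a + b).+1)%N by rewrite ltnS leq_addr.
rewrite (bigD1 (Ordinal ha)) //= addKn big1 ?addr0 // => i hi.
have [hlt|hge] := ltnP i a.
  by rewrite (nth_default _ (_ : size q <= a + b - i)%N) ?mulr0 //; move: h2 hlt; lia.
rewrite (nth_default _ (_ : size p <= i)%N) ?mul0r // (leq_trans h1) //.
by rewrite ltn_neqAle hge andbT; apply: contraNneq hi => E; apply/eqP/val_inj.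
Qed.

Lemma top_coefX p a c m : top_coef p a c -> top_coef (p ^+ m) (m * a) (c ^+ m).
Proof.
move=> h; elim: m => [|m IH]; first exact: top_coef1.
by rewrite !exprS mulSn; apply: top_coefM.
Qed.

Lemma top_coef_prod (I : Type) (r : seq I) (P : pred I) (F : I -> {poly C}) a G :
  (forall i, P i -> top_coef (F i) (a i) (G i)) ->
  top_coef (\prod_(i <- r | P i) F i) (\sum_(i <- r | P i) a i)
    (\prod_(i <- r | P i) G i).
Proof.
move=> h; apply: (big_ind3 (fun p n c => top_coef p n c)) => //.
  exact: top_coef1.
by move=> p1 n1 c1 p2 n2 c2; apply: top_coefM.
Qed.

Lemma top_coef_det n (A : 'M[{poly C}]_n) (a : 'I_n -> nat) :
  (forall i j, (size (A i j) <= (a i).+1)%N) ->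
  top_coef (\det A) (\sum_i a i) (\det (\matrix_(i, j) (A i j)`_(a i))).
Proof.
move=> h; rewrite /determinant; apply: top_coef_sum => s _.
have -> (x : {poly C}) : (-1) ^+ perm.odd_perm s * x = ((-1) ^+ perm.odd_perm s : C) *: x.
  by rewrite -mul_polyC rmorphXn rmorphN1.
apply: top_coefZ; apply: top_coef_prod => i _; split; first exact: h.
by rewrite mxE.
Qed.

(** The [g] for which [g%:M] factors through [J] form an ideal of C[t]. Full rank at every point
    leaves it without common zeros, so it contains a unit. *)
Lemma poly_right_inverse r N (J : 'M[{poly C}]_(r, N)) :
  (forall t : C, \rank (map_mx (horner^~ t) J) = r) ->
  exists B : 'M[{poly C}]_(N, r), J *m B = 1%:M.
Proof.
move=> hJ; pose ideal (g : {poly C}) := exists B : 'M_(N, r), J *m B = g%:M.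
have idD g h : ideal g -> ideal h -> ideal (g + h).
  by move=> [B hB] [B' hB']; exists (B + B'); rewrite mulmxDr hB hB' raddfD.
have idM k g : ideal g -> ideal (k * g).
  by move=> [B hB]; exists (k *: B); rewrite -scalemxAr hB scale_scalar_mx.
(* A constant right inverse [P] of [J] at [t] gives [g = det (J P)], which is 1 at [t] and lies in
   the ideal by the adjugate formula. *)
have loc t : exists2 g : {poly C}, ideal g & g.[t] != 0.
  have /row_freeP[P hP] : row_free (map_mx (horner^~ t) J) by rewrite /row_free hJ.
  pose P' := map_mx polyC P.
  exists (\det (J *m P')).
    by exists (P' *m \adj (J *m P')); rewrite mulmxA mul_mx_adj.
  suff -> : (\det (J *m P')).[t] = 1 by rewrite oner_neq0.
  rewrite -[LHS]/(horner_eval t _) -det_map_mx map_mxM /=.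
  rewrite -[RHS](det1 _ r) -hP; congr (\det (_ *m _)).
  by rewrite /P'; apply/matrixP => i j; rewrite !mxE /= /horner_eval hornerC.
suff [g [hg g0]] : exists g, ideal g /\ size g = 1%N.
  move/eqP/size_poly1P: g0 => [c c0 gE].
  have [B hB] := idM c^-1%:P g hg; exists B.
  by rewrite hB gE -polyCM mulVf.
have [g0 hg0 g00] := loc 0.
have {g00} : g0 != 0 by apply: contraNneq g00 => ->; rewrite horner0.
(* Euclidean descent: if [g] has a root [t], an element [h] of the ideal nonzero at [t] leaves a
   nonzero remainder modulo [g], of smaller size. *)
move: {2}(size g0) (leqnn (size g0)) => m.
elim: m g0 hg0 => [|m IH] g hg hs g0.
  by move: hs g0; rewrite leqn0 size_poly_eq0 => ->.
have [/eqP h1|] := boolP (size g == 1%N); first by exists g.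
move=> /closed_rootP[t /rootP gt].
have [h hh ht] := loc t.
apply: (IH (h %% g)).
- have -> : h %% g = h + (- (h %/ g)) * g by rewrite {2}(divp_eq h g); ring.
  by apply: idD => //; apply: idM.
- by rewrite -ltnS (leq_trans _ hs) // ltn_modp.
- apply: contraNneq ht => E; rewrite (divp_eq h g) E addr0 hornerM gt.
  by rewrite mulr0.
Qed.

(* [det (P|W^T) = det (B|W^T) * det (J P)] for every [P], where [J B = 1]:
   multiply [(P|W^T)] by the adjugate of [(B|W^T)]. *)
Lemma det_kernel_dual (R : idomainType) r s (J : 'M[R]_(r, r + s))
  (K : 'M[R]_(r + s, s)) (B P : 'M[R]_(r + s, r)) :
  J *m B = 1%:M -> J *m K = 0 -> \det (row_mx B K) != 0 ->
  \det (row_mx P K) = \det (row_mx B K) * \det (J *m P).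
Proof.
move=> hB hK; set M := row_mx B K; set l := \det M => l0.
have JM : J *m M = row_mx 1%:M 0 by rewrite mul_mx_row hB hK.
(* Since [J M = (1|0)], the upper block of [adj M] is [J M adj M = l J]. *)
have adjM : \adj M = col_mx (l *: J) (dsubmx (\adj M)).
  rewrite -[LHS]vsubmxK; congr col_mx.
  have : J *m M *m \adj M = l *: J by rewrite -mulmxA mul_mx_adj mul_mx_scalar.
  rewrite JM -[X in _ *m X]vsubmxK mul_row_col mul1mx mul0mx addr0 => <-.
  by [].
have h1 : \adj M *m M = l%:M by rewrite mul_adj_mx.
have h2 : \adj M *m K = col_mx 0 l%:M.
  move: (congr1 (@rsubmx _ _ r s) h1); rewrite mul_mx_row row_mxKr => ->.
  by rewrite scalar_mx_block block_mxEh row_mxKr.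
have h3 : \adj M *m row_mx P K =
    block_mx (l *: (J *m P)) 0 (dsubmx (\adj M) *m P) l%:M.
  rewrite mul_mx_row h2 {1}adjM mul_col_mx -scalemxAl.
  by rewrite block_mxEh.
have h4 : \det (\adj M) * l = l ^+ (r + s) by rewrite -det_mulmx h1 det_scalar.
have := congr1 determinant h3; rewrite det_mulmx det_lblock detZ det_scalar.
rewrite mulrAC -exprD => h5.
apply: (mulfI (expf_neq0 (r + s) l0)).
by rewrite -{1}h4 mulrAC h5 -mulrA; congr (_ * _); rewrite mulrC.
Qed.

(** Take a constant [P] inverting [J] on the right at infinity. Then [det (J P)] has degree exactly
    the sum of the [a i], while [det (P|W^T)] has degree at most the sum of the [b i]. By
    [det_kernel_dual] the first divides the second, which is nonzero. *)
Lemma kernel_degree_bound r s N (eN : N = (r + s)%N)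
  (J : 'M[{poly C}]_(r, N)) (W : 'M[{poly C}]_(s, N))
  (a : 'I_r -> nat) (b : 'I_s -> nat) (t0 : C) :
  J *m W^T = 0 ->
  (forall i j, (size (J i j) <= (a i).+1)%N) ->
  (forall i j, (size (W i j) <= (b i).+1)%N) ->
  (forall t : C, \rank (map_mx (horner^~ t) J) = r) ->
  \rank (\matrix_(i, j) (J i j)`_(a i)) = r ->
  \rank (map_mx (horner^~ t0) W) = s ->
  (\sum_i a i <= \sum_i b i)%N.
Proof.
subst N => JW sJ sW rJ /eqP rL rW.
have [B hB] := poly_right_inverse rJ.
have /row_freeP[P hP] := rL.
pose P' := map_mx polyC P.
have M0 : \det (row_mx B W^T) != 0.
  (* At [t0], applying [J] to a relation between the columns of [B] and [W^T] kills the [B] part,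
     and the rows of [W] are independent there. *)
  suff : \det (map_mx (horner_eval t0) (row_mx B W^T)) != 0.
    by rewrite det_map_mx; apply: contraNneq => ->; rewrite rmorph0.
  rewrite -det_tr -unitfE -unitmxE -row_free_unit -kermx_eq0.
  apply/rowV0P => v /sub_kermxP; rewrite map_row_mx tr_row_mx -[v]hsubmxK.
  rewrite mul_row_col => hv.
  have hJ : map_mx (horner_eval t0) B^T *m map_mx (horner_eval t0) J^T = 1%:M.
    by rewrite -map_mxM -trmx_mul hB trmx1 map_mx1.
  have hWJ : map_mx (horner_eval t0) W *m map_mx (horner_eval t0) J^T = 0.
    by rewrite -map_mxM -[W]trmxK -trmx_mul JW trmx0 map_mx0.
  have v1 : lsubmx v = 0.
    have := congr1 (mulmx^~ (map_mx (horner_eval t0) J^T)) hv.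
    rewrite mulmxDl mul0mx -!map_trmx trmxK -!mulmxA !map_trmx.
    by rewrite hJ hWJ mulmx1 mulmx0 addr0.
  move: hv; rewrite v1 mul0mx add0r -map_trmx trmxK => /eqP.
  rewrite mulmx_free_eq0 => [/eqP->|]; first by rewrite row_mx0.
  by rewrite /row_free -[X in _ == X]rW.
have det_eq := det_kernel_dual P' hB JW M0.
have [_ h1] : top_coef (\det (J *m P')) (\sum_i a i) 1.
  have hs i j : top_coef ((J *m P') i j) (a i) ((\matrix_(i, j) (J i j)`_(a i) *m P) i j).
    rewrite !mxE; apply: top_coef_sum => k _; rewrite !mxE mulrC [X in top_coef _ _ X]mulrC.
    by rewrite mul_polyC; apply: top_coefZ.
  have := top_coef_det (fun i j => proj1 (hs i j)).
  rewrite (_ : (\matrix_(i, j) ((J *m P') i j)`_(a i)) = 1%:M) ?det1 //.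
  by rewrite -hP; apply/matrixP => i j; rewrite mxE; apply: (proj2 (hs i j)).
have h2 : (size (\det (row_mx P' W^T)) <= (\sum_i b i).+1)%N.
  rewrite -det_tr tr_row_mx trmxK.
  pose bb (i : 'I_(r + s)) := if split i is inr k then b k else 0%N.
  have -> : (\sum_i b i = \sum_i bb i)%N.
    rewrite [RHS]big_split_ord /= [X in (X + _)%N]big1 => [|i _].
      by rewrite add0n; apply: eq_bigr => i _; rewrite /bb (unsplitK (inr i)).
    by rewrite /bb (unsplitK (inl i)).
  have [] // := top_coef_det (A := col_mx P'^T W) (a := bb).
  move=> i j; rewrite /bb mxE; case: splitP => k _; last exact: sW.
  by rewrite !mxE size_polyC; case: eqP.
have h3 : (\sum_i a i < size (\det (J *m P')))%N.
  by rewrite ltnNge; apply/negP => /(nth_default 0); rewrite h1 => /eqP; rewrite oner_eq0.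
have D0 : \det (J *m P') != 0 by rewrite -size_poly_gt0 (leq_trans _ h3).
rewrite -ltnS (leq_trans h3) // (leq_trans _ h2) // det_eq.
by apply: dvdp_leq; [rewrite mulf_neq0 | apply: dvdp_mull].
Qed.

End DegreeBound.

(** * Forms along a polynomial curve *)

Lemma expo_sum N d (m : mon N d) : (\sum_(j < N) expo m j = d)%N.
Proof. exact/eqP/(valP m). Qed.

Lemma expo_inj N d (m m' : mon N d) : expo m =1 expo m' -> m = m'.
Proof. by move=> h; apply/val_inj/eq_from_tnth => j; apply/val_inj/h. Qed.

Lemma mon_exists N d (g : 'I_N -> nat) :
  (\sum_(j < N) g j = d)%N -> exists m : mon N d, expo m =1 g.
Proof.
move=> hg; have hm j : (g j < d.+1)%N by rewrite ltnS -hg (bigD1 j) //= leq_addr.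
have hs : (\sum_(i < N) (tnth [tuple Ordinal (hm j) | j < N] i : nat) == d)%N.
  by rewrite -[X in _ == X]hg; apply/eqP; apply: eq_bigr => j _; rewrite tnth_mktuple.
exists (@exist _ (fun m : N.-tuple 'I_d.+1 =>
  is_true (\sum_(i < N) (tnth m i : nat) == d)%N) _ hs) => j.
by rewrite /expo tnth_mktuple.
Qed.

(* The monomial [m * x_b / x_l]; junk value [m] when [x_l] does not divide [m]. *)
Definition replace_var N d (m : mon N d) (l b : 'I_N) : mon N d :=
  odflt m [pick m' : mon N d | [forall j, expo m' j == expo m j - (j == l) + (j == b)]%N].

Lemma replace_varE N d (m : mon N d) l b j : (0 < expo m l)%N ->
  expo (replace_var m l b) j = (expo m j - (j == l) + (j == b))%N.
Proof.
move=> ml; rewrite /replace_var; case: pickP => [m' /forallP/(_ j)/eqP //|h].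
have [|m' hm'] := @mon_exists N d (fun j => expo m j - (j == l) + (j == b))%N; last first.
  by have := h m'; rewrite (introT forallP) // => i; rewrite hm'.
have E i : (1 = \sum_(j < N) (j == i))%N.
  by rewrite (bigD1 i) //= eqxx big1 // => k /negPf->.
(* The sum of the [(i == l)] is added to both sides to undo the truncated subtraction. *)
apply/eqP; rewrite big_split /= -(E b) -(eqn_add2r (\sum_(i < N) (i == l))).
rewrite addnAC -big_split /= -[X in _ == (d + X)%N](E l) eqn_add2r; apply/eqP.
rewrite (eq_bigr (expo m)) ?expo_sum // => i _; rewrite subnK //.
by case: eqP => // ->.
Qed.

Section Forms.
Variables (C : closedFieldType) (N : nat).

Lemma mon_factor (R : comPzRingType) d (m : mon N d) (x : 'I_N -> R) l :
  (0 < expo m l)%N ->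
  \prod_(j < N) x j ^+ expo m j =
  x l * (x l ^+ (expo m l).-1 * \prod_(j < N | j != l) x j ^+ expo m j).
Proof.
by move=> ml; rewrite (bigD1 l) //= mulrA -exprS prednK.
Qed.

Lemma mon_replace_var (R : comPzRingType) d (m : mon N d) (x : 'I_N -> R) l b :
  (0 < expo m l)%N ->
  \prod_(j < N) x j ^+ expo (replace_var m l b) j =
  x b * (x l ^+ (expo m l).-1 * \prod_(j < N | j != l) x j ^+ expo m j).
Proof.
move=> ml; rewrite (eq_bigr (fun j => x j ^+ (expo m j - (j == l))%N * x j ^+ (j == b))); last first.
  by move=> j _; rewrite replace_varE // exprD.
rewrite big_split /= mulrC; congr (_ * _).
  by rewrite (bigD1 b) //= eqxx big1 ?mulr1 // => i /negPf->.
rewrite (bigD1 l) //= eqxx subn1; congr (_ * _).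
by apply: eq_bigr => j /negPf->; rewrite subn0.
Qed.

Variable d : nat.
Implicit Types (F : hform C N d) (f g : 'I_N -> {poly C}).

Definition pform F f : {poly C} :=
  \sum_(m : mon N d) F m *: \prod_(j < N) f j ^+ expo m j.

(** The predecessor of an exponent 0 is harmless, since the factor [(expo m j)%:R] then vanishes. *)
Definition pform_deriv F j f : {poly C} :=
  \sum_(m : mon N d) (F m * (expo m j)%:R) *:
     (f j ^+ (expo m j).-1 * \prod_(l < N | l != j) f l ^+ expo m l).

Lemma pform_horner F f t : (pform F f).[t] = eval_form F (fun j => (f j).[t]).
Proof.
rewrite horner_sum; apply: eq_bigr => m _; rewrite hornerZ horner_prod.
by congr (_ * _); apply: eq_bigr => j _; rewrite horner_exp.
Qed.

Lemma pform_deriv_horner F j f t :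
  (pform_deriv F j f).[t] = deriv_form F j (fun j => (f j).[t]).
Proof.
rewrite horner_sum; apply: eq_bigr => m _; rewrite hornerZ hornerM horner_exp horner_prod.
by rewrite mulrA; congr (_ * _); apply: eq_bigr => l _; rewrite horner_exp.
Qed.

(** The coefficients of index [e] are the homogeneous coordinates of the curve at infinity whenever
    they are not all 0. *)
Lemma pform_top F f e : (forall j, (size (f j) <= e.+1)%N) ->
  top_coef (pform F f) (d * e) (eval_form F (fun j => (f j)`_e)).
Proof.
move=> hf; apply: top_coef_sum => m _; apply: top_coefZ.
rewrite -[X in (X * e)%N](expo_sum m) big_distrl /=.
by apply: top_coef_prod => j _; apply: top_coefX; split.
Qed.

Lemma pform_deriv_top F j f e : (forall j, (size (f j) <= e.+1)%N) ->
  top_coef (pform_deriv F j f) (d.-1 * e) (deriv_form F j (fun j => (f j)`_e)).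
Proof.
move=> hf; apply: top_coef_sum => m _.
have [m0|mj] := posnP (expo m j).
  by rewrite m0 mulr0 scale0r !mul0r; apply: top_coef0.
rewrite -[X in top_coef _ _ X]mulrA; apply: top_coefZ.
have -> : (d.-1 * e = (expo m j).-1 * e + \sum_(l < N | l != j) expo m l * e)%N.
  rewrite -big_distrl -mulnDl /=; congr (_ * e)%N.
  by rewrite -[in LHS](expo_sum m) (bigD1 j) //= -(prednK mj).
apply: top_coefM; first by apply: top_coefX; split.
by apply: top_coef_prod => l _; apply: top_coefX; split.
Qed.

Lemma pform_euler F f : \sum_(j < N) pform_deriv F j f * f j = d%:R *: pform F f.
Proof.
under eq_bigr do rewrite mulr_suml.
rewrite exchange_big /= scaler_sumr; apply: eq_bigr => m _.
transitivity (\sum_(j < N) (expo m j)%:R *: (F m *: \prod_(j < N) f j ^+ expo m j)).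
  apply: eq_bigr => j _; have [m0|mj] := posnP (expo m j).
    by rewrite m0 mulr0 !scale0r mul0r.
  by rewrite (mon_factor _ mj) -scalerAl scalerA [X in X *: _]mulrC; congr (_ *: _); rewrite mulrC.
by rewrite -scaler_suml -natr_sum expo_sum.
Qed.

Section Leibniz.
Variable D : {poly C} -> {poly C} -> Prop.
Hypotheses (D0 : D 0 0) (D1 : D 1 0)
  (DD : forall p q p' q', D p q -> D p' q' -> D (p + p') (q + q'))
  (DM : forall p q p' q', D p q -> D p' q' -> D (p * p') (p * q' + q * p')).

Lemma leibniz_exp p q m : D p q -> D (p ^+ m) (m%:R *: (p ^+ m.-1 * q)).
Proof.
move=> h; elim: m => [|m IH]; first by rewrite scale0r.
rewrite exprS; have := DM h IH; congr D.
case: m {IH} => [|m]; first by rewrite scale0r mulr0 add0r scale1r expr0 mulr1 mul1r.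
rewrite -scalerAr mulrA -exprS /= -[in X in _ + X = _]mulrC.
by rewrite -[m.+2]addn1 natrD scalerDl scale1r.
Qed.

Lemma leibniz_prod (I : eqType) (r : seq I) (p q : I -> {poly C}) : uniq r ->
  (forall j, D (p j) (q j)) ->
  D (\prod_(j <- r) p j) (\sum_(j <- r) q j * \prod_(l <- r | l != j) p l).
Proof.
move=> ur h; elim: r ur => [|i r IH] /=; first by rewrite !big_nil.
move=> /andP[ir ur]; have := DM (h i) (IH ur); rewrite !big_cons eqxx /= addrC.
congr (D _ (_ + _)).
  congr (_ * _); rewrite big_seq [RHS]big_seq_cond; apply: eq_bigl => l.
  by case: eqP => [->|_]; [rewrite (negPf ir) | rewrite andbT].
rewrite mulr_sumr [LHS]big_seq [RHS]big_seq; apply: eq_bigr => j jr.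
rewrite big_cons; case: eqP => [ij|_]; first by rewrite ij jr in ir.
by rewrite mulrCA.
Qed.

(** The relation [D] is abstract so as to cover both a partial derivation acting on coefficients,
    which yields deformations, and d/dt, which yields the chain rule. *)
Lemma leibniz_pform F F' f g :
  (forall m, D (F m)%:P (F' m)%:P) -> (forall j, D (f j) (g j)) ->
  D (pform F f) (pform F' f + \sum_(j < N) pform_deriv F j f * g j).
Proof.
move=> hF hf.
have -> : \sum_(j < N) pform_deriv F j f * g j = \sum_(m : mon N d) F m *:
  \sum_(j < N) (expo m j)%:R *: (f j ^+ (expo m j).-1 * g j) * \prod_(l < N | l != j) f l ^+ expo m l.
  under eq_bigr do rewrite mulr_suml.
  rewrite exchange_big; apply: eq_bigr => m _; rewrite scaler_sumr; apply: eq_bigr => j _.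
  rewrite -!scalerAl scalerA; congr (_ *: _).
  by rewrite mulrAC.
rewrite -big_split /=; apply: (big_ind2 D) => // m _.
rewrite -!mul_polyC addrC; apply: DM => //.
by apply: leibniz_prod => [|j]; [exact: index_enum_uniq | exact: leibniz_exp].
Qed.

End Leibniz.
End Forms.

(** * Lifting kernel vectors at a point to polynomial fields of degree 2e *)

Section Lifting.
Variables (C : closedFieldType) (N r : nat) (d : 'I_r -> nat).
Variable F : forall i, hform C N (d i).
Arguments F : clear implicits.
Variables (f : 'I_N -> {poly C}) (e : nat).
Hypothesis sf : forall j, (size (f j) <= e.+1)%N.
(** [w m] is a first-order deformation of [f] in the direction [m]: adding eps times the monomial to
    the [i]-th form and eps times [w m] to [f] leaves all values along [f] unchanged modulo
    eps^2. *)
Variable w : forall i, mon N (d i) -> 'I_N -> {poly C}.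
Hypothesis sw : forall i m j, (size (w (i := i) m j) <= e.+1)%N.
Hypothesis hw : forall i (m : mon N (d i)) i',
  \sum_(j < N) pform_deriv (F i') j f * w m j =
  if i' == i then - \prod_(j < N) f j ^+ expo m j else 0.

Variable t : C.
Let p j := (f j).[t].

Definition liftable (x : 'I_N -> C) := exists u : 'I_N -> {poly C},
  [/\ forall j, (size (u j) <= (2 * e).+1)%N,
      forall i, \sum_(j < N) pform_deriv (F i) j f * u j = 0 &
      forall j, (u j).[t] = x j].

Lemma liftable_ext x y : x =1 y -> liftable x -> liftable y.
Proof. by move=> h [u [h1 h2 h3]]; exists u; split=> // j; rewrite h3. Qed.

Lemma liftable_comb (I : Type) (s : seq I) (P : pred I) (k : I -> C) (x : I -> 'I_N -> C) :
  (forall i, P i -> liftable (x i)) ->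
  liftable (fun j => \sum_(i <- s | P i) k i * x i j).
Proof.
move=> h; elim: s => [|i s [u [h1 h2 h3]]].
  exists (fun=> 0); split=> j; rewrite ?size_poly0 ?big_nil ?horner0 //.
  by rewrite big1 // => l _; rewrite mulr0.
case Pi : (P i); last first.
  by exists u; split=> // j; rewrite h3 big_cons Pi.
have [v [g1 g2 g3]] := h i Pi.
exists (fun j => k i *: v j + u j); split=> [j|i'|j].
- rewrite (leq_trans (size_polyD _ _)) // geq_max h1 andbT.
  exact: leq_trans (size_scale_leq _ _) (g1 j).
- under eq_bigr do rewrite mulrDr -scalerAr.
  by rewrite big_split /= h2 -scaler_sumr g2 scaler0 addr0.
- by rewrite hornerD hornerZ h3 g3 big_cons Pi.
Qed.

Variables (b : 'I_N) (pb : p b != 0).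

(** Multiplying the monomial [m] by [f b] or [m x_b / x_l] by [f l] gives the same polynomial, so
    the two contributions to the [i]-th equation cancel. The products of two polynomials of degree
    [e] are the source of the bound [2 * e]. *)
Lemma liftable_swap i (m : mon N (d i)) l : (0 < expo m l)%N ->
  liftable (fun j => p b * (w m j).[t] - p l * (w (replace_var m l b) j).[t]).
Proof.
move=> ml; exists (fun j => f b * w m j - f l * w (replace_var m l b) j).
split=> [j|i'|j]; last by rewrite !hornerE.
  have sfw k m' : (size (f k * w (i := i) m' j)%R <= (2 * e).+1)%N.
    rewrite (leq_trans (size_polyMleq _ _)) //.
    by move: (sf k) (sw m' j); lia.
  by rewrite (leq_trans (size_polyD _ _)) // size_polyN geq_max !sfw.
under eq_bigr do rewrite mulrBr mulrCA (mulrCA _ (f l)).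
rewrite sumrB -!mulr_sumr !hw; case: eqP => _; last by rewrite !mulr0 subrr.
by rewrite (mon_factor _ ml) (mon_replace_var _ _ ml); ring.
Qed.

(** Modulo liftable vectors, a swap replaces the value of [w m] at [t] by [p l / p b] times that of
    [w (m x_b / x_l)]. Repeating this until only [x_b] remains gives a [y] that does not depend on
    [m]. *)
Lemma liftable_monomial i : exists y : 'I_N -> C, forall m : mon N (d i),
  liftable (fun j => (w m j).[t] - \prod_(j < N) p j ^+ expo m j * y j).
Proof.
have [|mb hmb] := @mon_exists N (d i) (fun j => if j == b then d i else 0%N).
  by rewrite -big_mkcond big_pred1_eq.
exists (fun j => (w mb j).[t] / p b ^+ d i) => m.
move: {2}(d i - expo m b)%N (erefl (d i - expo m b)%N) => n.
have sm (m' : mon N (d i)) : (d i = expo m' b + \sum_(j < N | j != b) expo m' j)%N.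
  by rewrite -[LHS](expo_sum m') (bigD1 b).
elim: n m => [|n IH] m hm.
  have -> : m = mb.
    apply: expo_inj => j; rewrite hmb.
    have hb : expo m b = d i by have := sm m; lia.
    have /eqP : (\sum_(j < N | j != b) expo m j = 0)%N by have := sm m; lia.
    rewrite sum_nat_eq0 => /forall_inP h; case: eqP => [->//|/eqP jb].
    exact/eqP/h.
  rewrite (bigD1 b) //= hmb eqxx big1 => [|j jb]; last by rewrite hmb (negPf jb) expr0.
  (* The empty combination: the zero vector is liftable. *)
  have := liftable_comb [::] (P := xpred0) (fun=> 0) (x := fun (_ : nat) _ => 0).
  move=> /(_ (fun i h => False_ind _ (notF h))); apply: liftable_ext => j.
  by rewrite big_nil; field; rewrite expf_neq0.
have [l lb ml] : exists2 l, l != b & (0 < expo m l)%N.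
  have : (0 < \sum_(j < N | j != b) expo m j)%N by have := sm m; lia.
  rewrite lt0n sum_nat_eq0 negb_forall_in => /exists_inP[l lb hl].
  by exists l; rewrite // lt0n.
have hm' : (d i - expo (replace_var m l b) b)%N = n.
  rewrite replace_varE // eqxx eq_sym (negPf lb); move: (sm m) hm; lia.
have := liftable_comb [:: true; false] (P := xpredT)
  (fun c : bool => if c then (p b)^-1 else p l / p b)
  (x := fun c : bool => if c then fun j => p b * (w m j).[t] - p l * (w (replace_var m l b) j).[t]
    else fun j => (w (replace_var m l b) j).[t] -
      \prod_(j < N) p j ^+ expo (replace_var m l b) j * ((w mb j).[t] / p b ^+ d i)).
move=> H; apply: liftable_ext (H _) => [j|[] _]; [|exact: liftable_swap|exact: IH].
rewrite !big_cons big_nil (mon_replace_var _ _ ml) (mon_factor _ ml).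
by field; rewrite pb expf_neq0.
Qed.

(* The linear vector field [x_b v / p_b] takes the value [v] at [p] and preserves
   the equations up to forms vanishing at [p]; those are corrected by combinations
   of the [w m], and these in turn lift because the forms vanish at [p]. *)
Lemma liftable_kernel (v : 'I_N -> C) :
  (forall i, \sum_(j < N) deriv_form (F i) j p * v j = 0) -> liftable v.
Proof.
move=> hv.
have /fin_all_exists[y hy] := liftable_monomial.
pose I := {i : 'I_r & (mon N (d i) * 'I_N)%type}.
(* [k a] is the coefficient with which [rv a] occurs in the derivative of the form along the linear
   field [x_b v / p_b]. *)
pose k (a : I) := F (tag a) (tagged a).1 * (expo (tagged a).1 (tagged a).2)%:R * v (tagged a).2 / p b.
pose rv (a : I) := replace_var (tagged a).1 (tagged a).2 b.
have lift1 : liftable (fun j => v j + \sum_(a : I) k a * (w (rv a) j).[t]).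
  exists (fun j => (v j / p b) *: f b + \sum_(a : I) k a *: w (rv a) j).
  split=> [j|i|j]; last first.
  - rewrite hornerD hornerZ horner_sum -/(p b) divfK //; congr (_ + _).
    by apply: eq_bigr => a _; rewrite hornerZ.
  - under eq_bigr do rewrite mulrDr mulr_sumr.
    rewrite big_split /= exchange_big /=.
    have -> : \sum_(a : I) \sum_(j < N) pform_deriv (F i) j f * (k a *: w (rv a) j) =
      \sum_(a : I) k a *: (if i == tag a then - \prod_(j < N) f j ^+ expo (rv a) j else 0).
      apply: eq_bigr => a _; rewrite -hw scaler_sumr.
      by apply: eq_bigr => j _; rewrite -scalerAr.
    have -> : \sum_(a : I) k a *: (if i == tag a then - \prod_(j < N) f j ^+ expo (rv a) j else 0) =
      \sum_i' \sum_(ml : mon N (d i') * 'I_N) k (Tagged _ ml) *: (if i == i' then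
         - \prod_(j < N) f j ^+ expo (rv (Tagged _ ml)) j else 0).
      rewrite sig_big_dep /=; apply: eq_big => // a _; by case: a.
    rewrite (bigD1 i) //= [X in _ + (_ + X)]big1 ?addr0; last first.
      move=> i' ii'; rewrite big1 // => ml _; rewrite eq_sym (negPf ii').
      by rewrite scaler0.
    rewrite eqxx /= -(pair_bigA _ (fun m l => k (Tagged _ (m, l)) *: - \prod_(j < N) f j ^+ expo (rv (Tagged _ (m, l))) j)) /=.
    rewrite exchange_big -big_split /= big1 // => l _.
    rewrite mulr_suml -big_split /= big1 // => m _; rewrite /k /rv /=.
    (* When [x_l] does not divide [m] the coefficient [k] is 0, so the junk value of [replace_var]
       does not matter. *)
    have [m0|ml] := posnP (expo m l).
      by rewrite m0 !(mulr0, mul0r, scale0r) addr0.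
    rewrite (mon_replace_var _ _ ml) -!mul_polyC !polyCM; ring.
  - rewrite (leq_trans (size_polyD _ _)) // geq_max; apply/andP; split.
      by rewrite (leq_trans (size_scale_leq _ _)) // (leq_trans (sf _)) // ltnS leq_pmull.
    rewrite (leq_trans (size_sum _ _ _)) //; apply/bigmax_leqP => a _.
    by rewrite (leq_trans (size_scale_leq _ _)) // (leq_trans (sw _ _)) // ltnS leq_pmull.
have lift2 := liftable_comb (index_enum I) (P := xpredT) k
  (fun a _ => hy (tag a) (rv a)).
have := liftable_comb [:: true; false] (P := xpredT)
  (fun c : bool => if c then 1 else -1)
  (x := fun c : bool => if c then _ else _) (fun c _ =>
    match c return liftable (if c then _ else _) with true => lift1 | false => lift2 end).
apply: liftable_ext => j; rewrite !big_cons big_nil addr0 mul1r mulN1r.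
rewrite -addrA -sumrB -[RHS]addr0; congr (_ + _).
(* What is left is a combination of the [y i] whose coefficients are the derivatives of the forms at
   [p] along [v], and these vanish by [hv]. *)
transitivity (\sum_(a : I) k a * \prod_(j < N) p j ^+ expo (rv a) j * y (tag a) j).
  by apply: eq_bigr => a _; ring.
transitivity (\sum_i (\sum_(ml : mon N (d i) * 'I_N) k (Tagged _ ml) *
   \prod_(j < N) p j ^+ expo (rv (Tagged _ ml)) j) * y i j).
  under [RHS]eq_bigr do rewrite mulr_suml.
  by rewrite sig_big_dep /=; apply: eq_big => // a _; case: a.
rewrite big1 // => i _.
rewrite -(pair_bigA _ (fun m l => k (Tagged _ (m, l)) * \prod_(j < N) p j ^+ expo (rv (Tagged _ (m, l))) j)) /=.
rewrite exchange_big /= -[RHS](mul0r (y i j)) -[in RHS](hv i); congr (_ * _).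
apply: eq_bigr => l _; rewrite mulr_suml; apply: eq_bigr => m _; rewrite /k /rv /=.
have [m0|ml] := posnP (expo m l); first by rewrite m0 !(mulr0, mul0r).
by rewrite (mon_replace_var _ _ ml); field.
Qed.

End Lifting.

(** The rows of [Y] at [t] are completed to a basis of the kernel of [J] by vectors lifting to
    fields of degree at most [2 * e]. Then [kernel_degree_bound] compares with the row degrees
    [(d i).-1 * e] of [J]. *)
Lemma kernel_vector_degree_bound (C : closedFieldType) (N r : nat) (d : 'I_r -> nat)
  (F : forall i, hform C N (d i)) (f : 'I_N -> {poly C}) (e : nat)
  (w : forall i, mon N (d i) -> 'I_N -> {poly C}) (t : C)
  (a : nat) (Y : 'M[{poly C}]_(a, N)) (y : 'I_a -> nat) :
  (forall j, (size (f j) <= e.+1)%N) ->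
  (forall i m j, (size (w i m j) <= e.+1)%N) ->
  (forall i (m : mon N (d i)) i',
    \sum_(j < N) pform_deriv (F i') j f * w i m j =
    if i' == i then - \prod_(j < N) f j ^+ expo m j else 0) ->
  (forall u : C, \rank (\matrix_(i < r, j < N) deriv_form (F i) j (fun j => (f j).[u])) = r) ->
  \rank (\matrix_(i < r, j < N) deriv_form (F i) j (fun j => (f j)`_e)) = r ->
  (exists j, (f j).[t] != 0) ->
  (forall k i, \sum_(j < N) pform_deriv (F i) j f * Y k j = 0) ->
  (forall k j, (size (Y k j) <= (y k).+1)%N) ->
  \rank (map_mx (horner^~ t) Y) = a ->
  (\sum_i (d i).-1 * e <= \sum_k y k + (N - r - a) * (2 * e))%N.
Proof.
move=> sf sw hw rJ rL [b pb] JY sY rY.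
pose J : 'M[{poly C}]_(r, N) := \matrix_(i, j) pform_deriv (F i) j f.
have JE u : map_mx (horner^~ u) J = \matrix_(i, j) deriv_form (F i) j (fun j => (f j).[u]).
  by apply/matrixP => i j; rewrite !mxE pform_deriv_horner.
pose K := kermx (map_mx (horner^~ t) J)^T.
set Y0 := map_mx (horner^~ t) Y in rY.
have rK : \rank K = (N - r)%N by rewrite mxrank_ker mxrank_tr JE rJ.
have YK : (Y0 <= K)%MS.
  apply/sub_kermxP/matrixP => k i; rewrite !mxE.
  have := congr1 (horner^~ t) (JY k i); rewrite horner_sum horner0 => h.
  by rewrite -[RHS]h; apply: eq_bigr => j _; rewrite !mxE hornerM mulrC.
pose V0 := row_base (K :\: Y0)%MS.
have rV : \rank (K :\: Y0)%MS = (N - r - a)%N.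
  have := mxrank_cap_compl K Y0; have h := capmx_idPr YK.
  by rewrite h rY rK; lia.
have lift (k : 'I_(\rank (K :\: Y0)%MS)) : exists u : 'I_N -> {poly C},
  [/\ forall j, (size (u j) <= (2 * e).+1)%N,
      forall i, \sum_(j < N) pform_deriv (F i) j f * u j = 0 &
      forall j, (u j).[t] = V0 k j].
  apply: (liftable_kernel sf sw hw pb) => i.
  have /sub_kermxP : (row k V0 <= K)%MS.
    by rewrite (submx_trans (row_sub _ _)) // eq_row_base diffmxSl.
  move/matrixP/(_ 0 i); rewrite !mxE => h; rewrite -[RHS]h.
  by apply: eq_bigr => j _; rewrite !mxE pform_deriv_horner mulrC.
have [U hU] := fin_all_exists lift.
pose V := \matrix_(k, j) U k j.
have VE : map_mx (horner^~ t) V = V0.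
  by apply/matrixP => k j; rewrite 2!mxE; case: (hU k) => _ _ ->.
pose bd (k : 'I_(a + \rank (K :\: Y0)%MS)) :=
  match split k with inl k => y k | inr _ => (2 * e)%N end.
have leaN : (a <= N - r)%N by rewrite -rK -[X in (X <= _)%N]rY mxrankS.
have lerN : (r <= N)%N by rewrite -rL rank_leq_col.
have := @kernel_degree_bound C r (a + \rank (K :\: Y0)%MS) N _ J (col_mx Y V)
  (fun i => ((d i).-1 * e)%N) bd t.
have -> : (\sum_k bd k = \sum_k y k + (N - r - a) * (2 * e))%N.
  rewrite big_split_ord /=; congr (_ + _)%N.
    by apply: eq_bigr => k _; rewrite /bd (unsplitK (inl k)).
  rewrite -[in RHS]rV -[X in (X * _)%N]card_ord -sum_nat_const.
  by apply: eq_bigr => k _; rewrite /bd (unsplitK (inr k)).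
apply.
- rewrite rV; lia.
- apply/matrixP => i k; rewrite !mxE.
  under eq_bigr do rewrite !mxE.
  case: (split k) => k'; first exact: JY.
  under eq_bigr do rewrite !mxE.
  by case: (hU k').
- by move=> i j; rewrite !mxE; case: (pform_deriv_top (F i) j sf).
- move=> k j; rewrite /bd mxE; case: (split k) => k' //; rewrite mxE.
  by case: (hU k').
- by move=> u; rewrite JE rJ.
- rewrite -[RHS]rL; congr (\rank _); apply/matrixP => i j; rewrite !mxE.
  by case: (pform_deriv_top (F i) j sf).
- rewrite map_col_mx VE -addsmxE.
  have -> : (Y0 + V0 :=: K)%MS; last by rewrite rK rV; lia.
  rewrite addsmxC; apply: eqmx_trans (addsmx_diff_cap_eq K Y0).
  have h := capmx_idPr YK.
  by apply: adds_eqmx; [exact: eq_row_base | exact: eqmx_sym].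
Qed.

(** * Wronskians of polynomials in one variable *)

Section Wronskian.
Variables (C : closedFieldType).
Hypothesis char0 : forall n, (n%:R == 0 :> C) = (n == 0%N).

(** After multiplication by [X], comparing top coefficients gives (deg g - deg h) times the product
    of the leading coefficients equal to 0. The factor [X] makes the degree of a constant no special
    case. *)
Lemma wronskian_eq0_size (g h : {poly C}) : g != 0 -> h != 0 ->
  g * h^`() = h * g^`() -> size g = size h.
Proof.
move=> g0 h0 E.
have top (p : {poly C}) : top_coef p (size p).-1 (lead_coef p).
  by split; [rewrite leqSpred | rewrite lead_coefE].
have top' (p : {poly C}) : top_coef ('X * p^`()) (size p).-1 ((size p).-1%:R * lead_coef p).
  split; last first.
    rewrite mulrC coefMX lead_coefE; case: (size p).-1 => [|n] /=; first by rewrite mul0r.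
    by rewrite coef_deriv mulr_natl.
  apply/leq_sizeP => -[|j] hj; rewrite mulrC coefMX //= coef_deriv nth_default ?mul0rn //.
  exact: leq_trans (leqSpred _) hj.
have Epoly : g * ('X * h^`()) = h * ('X * g^`()) by rewrite mulrCA E mulrCA.
have := proj2 (top_coefM (top g) (top' h)).
rewrite Epoly addnC (proj2 (top_coefM (top h) (top' g))) => /eqP.
rewrite -subr_eq0.
have -> : lead_coef h * ((size g).-1%:R * lead_coef g) -
    lead_coef g * ((size h).-1%:R * lead_coef h) =
  ((size g).-1%:R - (size h).-1%:R) * (lead_coef g * lead_coef h) by ring.
rewrite !mulf_eq0 !lead_coef_eq0 (negPf g0) (negPf h0) !orbF.
have sg : (0 < size g)%N by rewrite size_poly_gt0.
have sh : (0 < size h)%N by rewrite size_poly_gt0.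
move: (size g) (size h) sg sh => m n m0 n0.
case: (leqP n m) => hle.
  rewrite -natrB; last by lia.
  by rewrite char0; lia.
rewrite -oppr_eq0 opprB -natrB; last by lia.
by rewrite char0; lia.
Qed.

(** Subtracting the multiple of [h] with the same leading term leaves a remainder with the same
    relation but smaller size, so it is 0. *)
Lemma wronskian_eq0 (g h : {poly C}) : h != 0 ->
  g * h^`() = h * g^`() -> exists c, g = c *: h.
Proof.
move=> h0 E; have [->|g0] := eqVneq g 0; first by exists 0; rewrite scale0r.
have sgh := wronskian_eq0_size g0 h0 E.
exists (lead_coef g / lead_coef h); apply/eqP; rewrite -subr_eq0.
apply: contraT => q0; set q := g - _ in q0.
have Eq : q * h^`() = h * q^`().
  by rewrite /q derivB derivZ mulrBl mulrBr E -scalerAl -scalerAr.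
have := wronskian_eq0_size q0 h0 Eq.
suff : (size q < size h)%N by move=> + E'; rewrite E' ltnn.
have sh : (0 < size h)%N by rewrite size_poly_gt0.
rewrite -(prednK sh) ltnS; apply/leq_sizeP => j hj.
rewrite coefB coefZ; have [->|hj'] := eqVneq j (size h).-1.
  by rewrite -[X in _ * X]lead_coefE divfK ?lead_coef_eq0 // lead_coefE sgh subrr.
have hjh : (size h <= j)%N by rewrite -(prednK sh) ltn_neqAle eq_sym hj' hj.
by rewrite !nth_default ?sgh // mulr0 subrr.
Qed.

End Wronskian.

(** * Deformations of curves on very general pairs *)

Section Deformation.
Variable C : closedFieldType.
Hypothesis char0 : forall n, (n%:R == 0 :> C) = (n == 0%N).

Lemma exists_coef_derivation (I : finType) (s : I -> C) N (f : 'I_N -> {poly C}) a :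
  alg_independent s ->
  exists B, [/\ partial_derivation B, forall b, B (s b) (b == a)%:R &
    exists g : 'I_N -> {poly C}, forall j,
      pder_poly B (f j) (g j) /\ (size (g j) <= size (f j))%N].
Proof.
move=> hs; have [B0 [hB0 B0s]] := alg_independent_pder char0 a hs.
have [B [hB B0B hB1]] := pder_adjoin_seq char0 (flatten [seq polyseq (f j) | j <- enum 'I_N]) hB0.
exists B; split=> // [b|]; first exact/B0B/B0s.
have coef j : exists y : 'I_(size (f j)) -> C,
      forall i : 'I_(size (f j)), B (f j)`_i (y i).
  apply: (@fin_all_exists _ (fun=> C) (fun (i : 'I_(size (f j))) y => B (f j)`_i y)) => i.
  apply: hB1; apply/flattenP; exists (f j : seq C); last exact: mem_nth.
  by apply: map_f; rewrite mem_enum.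
have : forall j, exists g : {poly C}, pder_poly B (f j) g /\ (size g <= size (f j))%N.
  move=> j; have [y hy] := coef j.
  exists (\poly_(i < size (f j)) (if insub i is Some i' then y i' else 0)).
  split; last exact: size_poly.
  move=> i; rewrite coef_poly; case: ltnP => hi; last first.
    by rewrite nth_default //; apply: pder0.
  by rewrite insubT /=; apply: (hy (Ordinal hi)).
by move/fin_all_exists => [g hg]; exists g.
Qed.

(* Constant values of the forms along [f] have constant derivatives; Euler's
   relation absorbs these by subtracting a multiple of [f]. *)
Lemma exists_deformations (I : finType) (s : I -> C) N r (d : 'I_r -> nat)
  (F : forall i, hform C N (d i)) (f : 'I_N -> {poly C}) (g : 'I_r -> C)
  (idx : forall i, mon N (d i) -> I) e :
  alg_independent s ->
  (forall i m, s (idx i m) = F i m) ->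
  (forall i, injective (idx i)) ->
  (forall i i' m m', i != i' -> idx i m != idx i' m') ->
  (forall j, (size (f j) <= e.+1)%N) ->
  (forall i, (0 < d i)%N) ->
  (forall i, pform (F i) f = (g i)%:P) ->
  (forall i i', g i != 0 -> g i' != 0 -> i = i') ->
  exists w : forall i, mon N (d i) -> 'I_N -> {poly C},
    (forall i m j, (size (w i m j) <= e.+1)%N) /\
    (forall i (m : mon N (d i)) i',
      \sum_(j < N) pform_deriv (F i') j f * w i m j =
      if i' == i then - \prod_(j < N) f j ^+ expo m j else 0).
Proof.
move=> hs sF idx_inj idx_neq sf d0 Ff g_uniq.
have ex i (m : mon N (d i)) : exists w : 'I_N -> {poly C},
    (forall j, (size (w j) <= e.+1)%N) /\
    (forall i', \sum_(j < N) pform_deriv (F i') j f * w j =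
      if i' == i then - \prod_(j < N) f j ^+ expo m j else 0).
  have [B [hB Bs [h hh]]] := exists_coef_derivation f (idx i m) hs.
  have [D0 D1] : pder_poly B 0 0 /\ pder_poly B 1 0.
    by split; [exact: (pder_polyC hB (pder0 hB)) | exact: (pder_polyC hB (pder1 hB))].
  pose F' i' (m' : mon N (d i')) : C := (idx i' m' == idx i m)%:R.
  have F'E i' : pform (@F' i') f = if i' == i then \prod_(j < N) f j ^+ expo m j else 0.
    case: eqP => [->|/eqP ii'].
      rewrite /pform (bigD1 m) //= /F' eqxx scale1r [X in _ + X]big1 ?addr0 // => m' mm'.
      by rewrite (inj_eq (idx_inj i)) (negPf mm') scale0r.
    rewrite /pform big1 // => m' _.
    by rewrite /F' (negPf (idx_neq _ _ m' m ii')) scale0r.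
  (* A derivation sends the constant polynomial [g i'] to a constant, and 0 to 0. *)
  have key i' : exists k, (g i' = 0 -> k = 0) /\
      pform (@F' i') f + \sum_(j < N) pform_deriv (F i') j f * h j = k%:P.
    have hD : pder_poly B (pform (F i') f)
        (pform (@F' i') f + \sum_(j < N) pform_deriv (F i') j f * h j).
      apply: leibniz_pform => //.
      - by move=> *; apply: pder_polyD.
      - by move=> *; apply: pder_polyM.
      - by move=> m'; apply: pder_polyC => //; rewrite -sF.
      - by move=> j; case: (hh j).
    move: hD; move: (_ + _) => q hD; exists q`_0; split.
      move=> g0; apply: (pder_uniq0 hB); have := hD 0%N.
      by rewrite Ff coefC /= g0.
    apply/polyP => -[|l]; rewrite coefC //=; apply: (pder_uniq0 hB).
    by have := hD l.+1; rewrite Ff coefC.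
  have [k hk] := fin_all_exists key.
  (* At most one [g i] is nonzero, so a single multiple of [f] corrects all the equations. *)
  pose lam := if [pick i0 | g i0 != 0] is Some i0 then k i0 / ((d i0)%:R * g i0) else 0.
  have hlam i' : lam * ((d i')%:R * g i') = k i'.
    rewrite /lam; case: pickP => [i0 gi0|hg0].
      have [gi'|gi'] := eqVneq (g i') 0.
        by rewrite gi' !mulr0 (proj1 (hk i') gi').
      rewrite (g_uniq _ _ gi' gi0) divfK // mulf_neq0 //.
      by rewrite char0 -lt0n.
    have /negbFE/eqP gi' := hg0 i'.
    by rewrite mul0r (proj1 (hk i') gi').
  exists (fun j => h j - lam *: f j); split=> [j|i'].
    rewrite (leq_trans (size_polyD _ _)) // size_polyN geq_max.
    rewrite (leq_trans (proj2 (hh j))) //=.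
    exact: leq_trans (size_scale_leq _ _) (sf j).
  under eq_bigr do rewrite mulrBr -scalerAr.
  rewrite sumrB -scaler_sumr pform_euler Ff.
  have [_] := hk i'; rewrite -hlam F'E => /(canRL (addKr _)) ->.
  rewrite -!mul_polyC -!polyCM mulrA addrK.
  by case: eqP => // _; rewrite oppr0.
have := fun i => @fin_all_exists _ (fun=> 'I_N -> {poly C}) _ (ex i).
move=> /(@fin_all_exists _ (fun i => mon N (d i) -> 'I_N -> {poly C})) [w hw].
by exists w; split=> i m; case: (hw i m).
Qed.

Lemma pform_chain_rule N d (F : hform C N d) (f : 'I_N -> {poly C}) :
  \sum_(j < N) pform_deriv F j f * (f j)^`() = (pform F f)^`().
Proof.
have := @leibniz_pform C N d (fun p q => q = p^`()) _ _ _ _ F (fun=> 0) f (fun j => (f j)^`()).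
rewrite [X in X + _]/pform big1 ?add0r => [H|m _]; last by rewrite scale0r.
apply: H => //.
- by rewrite deriv0.
- by rewrite derivC.
- by move=> p q p' q' -> ->; rewrite derivD.
- by move=> p q p' q' -> ->; rewrite derivM addrC.
- by move=> m; rewrite derivC.
Qed.

Lemma eval_form_euler N d (F : hform C N d) (x : 'I_N -> C) :
  \sum_(j < N) deriv_form F j x * x j = d%:R * eval_form F x.
Proof.
have := congr1 (horner^~ 0) (pform_euler F (fun j => (x j)%:P)).
rewrite hornerZ pform_horner horner_sum /eval_form => h.
transitivity (\sum_(j < N) (pform_deriv F j (fun j => (x j)%:P) * (x j)%:P).[0]).
  apply: eq_bigr => j _; rewrite hornerM pform_deriv_horner hornerC.
  congr (_ * _); apply: eq_bigr => m _; rewrite hornerC; congr (_ * _).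
  by apply: eq_bigr => l _; rewrite hornerC.
rewrite h; congr (_ * _); apply: eq_bigr => m _; congr (_ * _).
by apply: eq_bigr => l _; rewrite hornerC.
Qed.

(** Smoothness controls [jacD] only on D. Elsewhere on X, pairing a row relation with [x] kills the
    rows of the [F i] by Euler and leaves [k * G(x)], so the last coefficient is 0. *)
Lemma rank_jacD_off_boundary n c (d : 'I_c -> nat) k
  (F : forall i, hform C n.+1 (d i)) (G : hform C n.+1 k) x :
  (0 < k)%N -> \rank (jacX F x) = c -> (forall i, eval_form (F i) x = 0) ->
  eval_form G x != 0 -> \rank (jacD F G x) = (c + 1)%N.
Proof.
move=> k0 rX Fx Gx; apply/eqP; rewrite -[_ == _]/(row_free _) -kermx_eq0.
apply/rowV0P => v /sub_kermxP; rewrite -[v]hsubmxK mul_row_col => hv.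
have v2 : rsubmx v = 0.
  have := congr1 (mulmx^~ (\col_j x j)) hv.
  rewrite mulmxDl -!mulmxA mul0mx (_ : jacX F x *m _ = 0) ?mulmx0 ?add0r; last first.
    apply/matrixP => i j; rewrite !mxE; under eq_bigr do rewrite !mxE.
    by rewrite eval_form_euler Fx mulr0.
  rewrite (_ : \row_j deriv_form G j x *m _ = (k%:R * eval_form G x)%:M); last first.
    apply/matrixP => i j; rewrite !mxE !ord1 eqxx mulr1n -eval_form_euler.
    by apply: eq_bigr => l _; rewrite !mxE.
  rewrite mul_mx_scalar => /eqP; rewrite scaler_eq0 mulf_eq0 (negPf Gx) orbF char0.
  by case: k k0 {hv G Gx} => // k _ /eqP.
move: hv; rewrite v2 mul0mx addr0 => /eqP.
by rewrite mulmx_free_eq0 /row_free ?rX // => /eqP->; rewrite row_mx0.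
Qed.

Section NonConstantCurve.
Variables (N : nat) (f : 'I_N -> {poly C}).
Hypothesis f_nonconst : exists t1 t2 : C, exists i j,
  (f i).[t1] * (f j).[t2] != (f j).[t1] * (f i).[t2].

Lemma exists_exact_degree : exists e, [/\ (0 < e)%N,
  forall j, (size (f j) <= e.+1)%N & exists j, (f j)`_e != 0].
Proof.
have [t1 [t2 [i [j hij]]]] := f_nonconst.
pose e := (\max_(j < N) (size (f j)).-1)%N.
have sf l : (size (f l) <= e.+1)%N.
  by rewrite (leq_trans (leqSpred _)) // ltnS (leq_bigmax l).
have e0 : (0 < e)%N.
  rewrite lt0n; apply: contraNneq hij => e0.
  have fC l : exists x, f l = x%:P.
    by exists (f l)`_0; apply: size1_polyC; rewrite -[1%N]/(0.+1) -e0.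
  by have [x ->] := fC i; have [y ->] := fC j; rewrite !hornerC mulrC.
exists e; split=> //.
have [l hl] : {l | e = (size (f l)).-1}.
  by apply: eq_bigmax; rewrite card_ord (leq_ltn_trans (leq0n i)).
exists l; rewrite hl -lead_coefE lead_coef_eq0; apply: contraTneq e0 => fl.
by rewrite hl fl size_poly0.
Qed.

Lemma exists_deriv_neq0 : exists t j, (f j)^`().[t] != 0.
Proof.
have [t1 [t2 [i [j hij]]]] := f_nonconst.
apply: NNPP => h; have fC l : exists x, f l = x%:P.
  exists (f l)`_0; apply: (deriv_eq0 char0); apply: (poly_fun0 char0) => t.
  by apply/eqP; apply: contraT => ht; case: h; exists t, l.
by move: hij; have [x ->] := fC i; have [y ->] := fC j; rewrite !hornerC mulrC eqxx.
Qed.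

(** Otherwise all Wronskians of the coordinates vanish and the coordinates are proportional, so the
    map to projective space is constant. *)
Lemma exists_wronskian_neq0 : exists t i j,
  (f i).[t] * (f j)^`().[t] - (f j).[t] * (f i)^`().[t] != 0.
Proof.
have [t1 [t2 [i [j hij]]]] := f_nonconst.
apply: NNPP => h; have W a b : f a * (f b)^`() = f b * (f a)^`().
  apply/eqP; rewrite -subr_eq0; apply/eqP; apply: (poly_fun0 char0) => t.
  rewrite hornerD hornerN !hornerM.
  by apply/eqP; apply: contraT => ht; case: h; exists t, a, b.
have [fj|fj] := eqVneq (f j) 0; first by rewrite fj !horner0 mulr0 mul0r eqxx in hij.
have [x fi] := wronskian_eq0 char0 fj (W i j).
by move: hij; rewrite fi !hornerZ mulrCA mulrA eqxx.
Qed.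

End NonConstantCurve.
End Deformation.

(** [Z j] is the hypersurface of the integer polynomial with code [j] if that polynomial is not
    identically 0. For any other code it is the empty locus of the constant 1. *)
Lemma very_general_alg_independent (C : fieldType) (I : finType) :
  exists Z : nat -> mpoly C I -> Prop, (forall j, proper_closed (Z j)) /\
    forall s, (forall j, ~ in_zero_locus (Z j) s) -> alg_independent s.
Proof.
pose good j (P : int_mpoly I) :=
  unpickle j = Some P /\ exists s' : I -> C, mpoly_eval (of_int_mpoly C P) s' != 0.
exists (fun j Q => (exists P, good j P /\ Q = of_int_mpoly C P) \/
  (~ (exists P, good j P) /\ Q = [:: (1, fun=> 0%N)])); split=> [j|s hs P P0 s'].
  case: (classic (exists P, good j P)) => [[P gP]|nP].
    have [_ [s' hs']] := gP; exists s' => /(_ (of_int_mpoly C P)) h.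
    by move: hs'; rewrite h ?eqxx //; left; exists P.
  exists (fun=> 0) => /(_ [:: (1, fun=> 0%N)]) h; have := h (or_intror (conj nP erefl)).
  rewrite /mpoly_eval big_seq1 big1 ?mulr1 => [/eqP|i _]; last by rewrite expr0.
  by rewrite oner_eq0.
apply/eqP; apply: contraT => Ps'; case: (hs (pickle P)) => Q.
case=> [[P' [[]]]|[[]]]; first by rewrite pickleK => -[<-] _ ->.
by exists P; split; [exact: pickleK | exists s'].
Qed.

Lemma sum_predn_mul (c e : nat) (d : 'I_c -> nat) : (forall i, 0 < d i)%N ->
  (\sum_i (d i).-1 * e + c * e = (\sum_i d i) * e)%N.
Proof.
move=> d0; have -> : (c * e = \sum_(i < c) e)%N by rewrite sum_nat_const card_ord.
rewrite -big_split big_distrl /=; apply: eq_bigr => i _.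
by rewrite -mulSnr prednK.
Qed.

(** * Degree contradictions for nonempty and for empty boundary *)

Section NoCurve.
Variable C : closedFieldType.
Hypothesis char0 : forall n, (n%:R == 0 :> C) = (n == 0%N).
Variables (n c : nat) (d : 'I_c -> nat) (k : nat).
Hypotheses (hd : forall i, (0 < d i)%N) (hnc : (c + 2 <= n)%N)
  (hdeg : (2 * n - c <= \sum_(i < c) d i + k)%N).
Variables (F : forall i : 'I_c, hform C n.+1 (d i)) (G : hform C n.+1 k).
Arguments F : clear implicits.
Hypotheses (FG_smooth : smooth_pair F G) (FG_indep : alg_independent (S_coords F G)).
Variable f : 'I_n.+1 -> {poly C}.
Hypothesis f_curve : A1_curve F G f.

Let f_neq0 t : nonzero_pt (fun j => (f j).[t]).
Proof. by case: f_curve => h _; exact: h. Qed.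

Let f_nonconst : exists t1 t2 : C, exists i j,
  (f i).[t1] * (f j).[t2] != (f j).[t1] * (f i).[t2].
Proof. by case: f_curve => _ [_ [_ h]]. Qed.

Let Ff i : pform (F i) f = 0.
Proof.
case: f_curve => _ [h _]; apply: (poly_fun0 char0) => t.
by rewrite pform_horner h.
Qed.

Let Gf : exists2 g, g != 0 & pform G f = g%:P.
Proof.
case: f_curve => _ [_ [h _]].
have : size (pform G f) == 1%N.
  apply: contraT => /closed_rootP[t]; rewrite rootE pform_horner => Gt.
  by have := h t; rewrite Gt.
by case/size_poly1P => g g0 ->; exists g.
Qed.

Let onX_f t : onX F (fun j => (f j).[t]).
Proof. by split=> // i; rewrite -pform_horner Ff horner0. Qed.

Let onX_infty e : (forall j, (size (f j) <= e.+1)%N) -> (exists j, (f j)`_e != 0) ->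
  onX F (fun j => (f j)`_e).
Proof.
move=> sf q0; split=> // i.
by have [_ <-] := pform_top (F i) sf; rewrite Ff coef0.
Qed.

(** Here [G] is one of the equations. The field [f] is not in the kernel, as Euler gives [k * g] in
    the last row, so only [f'] starts the basis. *)
Lemma A1_curve_log_absurd : (0 < k)%N -> False.
Proof.
move=> k0; have [e [e0 sf q0]] := exists_exact_degree f_nonconst.
have [rX rD] := FG_smooth; have [g g0 Gg] := Gf.
(* The forms [F i] and [G] become one family through [split], so that the dependent degrees compute
   by cases without casts. *)
pose dS (a : 'I_c + 'I_1) := if a is inl i then d i else k.
pose FS a : hform C n.+1 (dS a) := match a with inl i => F i | inr _ => G end.
pose iS a : mon n.+1 (dS a) -> S_index n c d k := match a with
  | inl i => fun m => inl (Tagged (fun i => mon n.+1 (d i)) m)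
  | inr _ => fun m => inr m end.
pose gS (a : 'I_c + 'I_1) := if a is inl _ then 0 else g.
pose D (i : 'I_(c + 1)) := dS (split i).
pose FG (i : 'I_(c + 1)) : hform C n.+1 (D i) := FS (split i).
have FG_jac x : \matrix_(i < c + 1, j < n.+1) deriv_form (FG i) j x = jacD F G x.
  by apply/matrixP => i j; rewrite !mxE /FG /D; case: (split i) => i'; rewrite !mxE.
have onq := onX_infty sf q0.
(* The constant [G(f)] has coefficient 0 in degree [k * e > 0]: the point at infinity lies on D,
   where smoothness of D gives the rank. *)
have Gq : eval_form G (fun j => (f j)`_e) = 0.
  have [_ <-] := pform_top G sf; rewrite Gg coefC.
  by case: eqP => // /eqP; rewrite muln_eq0; lia.
have FGf i : pform (FG i) f = (gS (split i))%:P.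
  by rewrite /FG /D; case: (split i) => i' /=; rewrite ?Ff.
have [w [sw hw]] : exists w : forall i, mon n.+1 (D i) -> 'I_n.+1 -> {poly C},
    (forall i m j, (size (w i m j) <= e.+1)%N) /\
    (forall i (m : mon n.+1 (D i)) i',
      \sum_(j < n.+1) pform_deriv (FG i') j f * w i m j =
      if i' == i then - \prod_(j < n.+1) f j ^+ expo m j else 0).
  apply: (exists_deformations char0 (idx := fun i => @iS (split i)) FG_indep _ _ _ sf _ FGf).
  - by move=> i; rewrite /FG /D; case: (split i).
  - move=> i; rewrite /D; case: (split i) => i' m m' /=; last by case.
    by move=> [] /eqP; rewrite eq_Tagged => /eqP.
  - move=> i i'; rewrite -(inj_eq (can_inj (@splitK c 1))) /D.
    case: (split i) (split i') => [a|a] [b|b] //= m m' ab; last by rewrite !ord1 eqxx in ab.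
    by apply: contraNneq ab => -[E _]; rewrite E.
  - by move=> i; rewrite /D; case: (split i) => /=.
  - move=> i i'; rewrite -{2}(splitK i) -{2}(splitK i').
    case: (split i) (split i') => [a|a] [b|b] /=; rewrite ?eqxx // => _ _.
    by rewrite (ord1 a) (ord1 b).
have [t [l hl]] := exists_deriv_neq0 char0 f_nonconst.
have := kernel_vector_degree_bound (t := t) (Y := \row_j (f j)^`()) (y := fun=> e.-1)
  sf sw hw.
have -> : (\sum_(i < c + 1) (D i).-1 * e = \sum_i (d i).-1 * e + k.-1 * e)%N.
  rewrite big_split_ord big_ord1 /D; congr (_ + _)%N.
    by apply: eq_bigr => i _; rewrite (unsplitK (inl i)).
  by rewrite (unsplitK (inr ord0)).
rewrite big_ord1 => /(_ _ _ (f_neq0 t)) H.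
have {H} : (\sum_i (d i).-1 * e + k.-1 * e <= e.-1 + (n.+1 - (c + 1) - 1) * (2 * e))%N.
  apply: H => [u||a i|a j|].
  - rewrite FG_jac; have [onu Fu] := onX_f u.
    apply: (rank_jacD_off_boundary char0) => //; first exact: rX.
    by rewrite -pform_horner Gg hornerC.
  - by rewrite FG_jac rD.
  - under eq_bigr do rewrite mxE.
    by rewrite pform_chain_rule FGf derivC.
  - rewrite mxE prednK //; have [->|fj] := eqVneq (f j) 0.
      by rewrite deriv0 size_poly0.
    by rewrite -ltnS (leq_trans (lt_size_deriv fj)).
  - rewrite rank_rV; case: eqP => // /rowP/(_ l); rewrite !mxE => /eqP.
    by rewrite (negPf hl).
have := sum_predn_mul e hd; have := leq_mul hdeg (leqnn e).
rewrite (_ : n.+1 - (c + 1) - 1 = n - c - 1)%N; last by lia.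
(* This removes truncated subtraction; the contradiction becomes (2m+3)e <= (2m+3)e - 1. *)
have [m ->] : exists m, n = (c + 2 + m)%N by exists (n - (c + 2))%N; lia.
rewrite (_ : 2 * (c + 2 + m) - c = c + 4 + 2 * m)%N; last by lia.
rewrite (_ : c + 2 + m - c - 1 = m.+1)%N; last by lia.
by case: k k0 => // k' _ /=; nia.
Qed.

Lemma A1_curve_projective_absurd : k = 0%N -> False.
Proof.
move=> k0; have [e [e0 sf q0]] := exists_exact_degree f_nonconst.
have [rX _] := FG_smooth.
pose iS i (m : mon n.+1 (d i)) : S_index n c d k := inl (Tagged (fun i => mon n.+1 (d i)) m).
have [w [sw hw]] : exists w : forall i, mon n.+1 (d i) -> 'I_n.+1 -> {poly C},
    (forall i m j, (size (w i m j) <= e.+1)%N) /\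
    (forall i (m : mon n.+1 (d i)) i',
      \sum_(j < n.+1) pform_deriv (F i') j f * w i m j =
      if i' == i then - \prod_(j < n.+1) f j ^+ expo m j else 0).
  apply: (exists_deformations char0 (idx := iS) (g := fun=> 0) FG_indep _ _ _ sf hd).
  - by [].
  - by move=> i m m' [] /eqP; rewrite eq_Tagged => /eqP.
  - by move=> i i' m m'; apply: contraNneq => -[E _]; rewrite E.
  - by move=> i; rewrite Ff.
  - by move=> i i'; rewrite eqxx.
have [t [a [b hab]]] := exists_wronskian_neq0 char0 f_nonconst.
pose Y : 'M[{poly C}]_(2, n.+1) := \matrix_(l, j) if l == 0 then f j else (f j)^`().
have := kernel_vector_degree_bound (t := t) (Y := Y)
  (y := fun l => if l == 0 then e else e.-1) sf sw hw.
rewrite big_ord_recl big_ord1 /= => /(_ _ _ (f_neq0 t)) H.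
have {H} : (\sum_i (d i).-1 * e <= e + e.-1 + (n.+1 - c - 2) * (2 * e))%N.
  apply: H => [u||l i|l j|].
  - exact/rX/onX_f.
  - exact/rX/onX_infty.
  - under eq_bigr do rewrite mxE.
    case: eqP => _; first by rewrite pform_euler Ff scaler0.
    by rewrite pform_chain_rule Ff deriv0.
  - rewrite mxE; case: eqP => _ //; rewrite prednK //.
    have [->|fj] := eqVneq (f j) 0; first by rewrite deriv0 size_poly0.
    by rewrite -ltnS (leq_trans (lt_size_deriv fj)).
  - apply/eqP; rewrite -[_ == _]/(row_free _) -kermx_eq0.
    apply/rowV0P => v /sub_kermxP/rowP hv.
    have {}hv j : v 0 0 * (f j).[t] + v 0 1 * (f j)^`().[t] = 0.
      have := hv j; rewrite !mxE big_ord_recl big_ord1 !mxE /=.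
      by rewrite (_ : lift 0 0 = 1) //; apply/val_inj.
    (* Eliminating [v 0 0] between the coordinates [a] and [b] leaves [v 0 1] times the
       Wronskian. *)
    have v1 : v 0 1 = 0.
      have : v 0 1 * ((f a).[t] * (f b)^`().[t] - (f b).[t] * (f a)^`().[t]) =
        (f a).[t] * (v 0 0 * (f b).[t] + v 0 1 * (f b)^`().[t]) -
        (f b).[t] * (v 0 0 * (f a).[t] + v 0 1 * (f a)^`().[t]) by ring.
      by rewrite !hv !mulr0 subr0 => /eqP; rewrite mulf_eq0 (negPf hab) orbF => /eqP.
    have [j fj] := f_neq0 t.
    have v0 : v 0 0 = 0.
      by have /eqP := hv j; rewrite v1 mul0r addr0 mulf_eq0 (negPf fj) orbF => /eqP.
    apply/rowP => l; rewrite mxE.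
    by case: (unliftP 0 l) => [l'|] ->; rewrite ?v0 // ord1 -[RHS]v1; congr (v _ _); apply/val_inj.
have := sum_predn_mul e hd; have := leq_mul hdeg (leqnn e).
(* The contradiction becomes (2m+4)e <= (2m+4)e - 1. *)
have [m ->] : exists m, n = (c + 2 + m)%N by exists (n - (c + 2))%N; lia.
rewrite (_ : 2 * (c + 2 + m) - c = c + 4 + 2 * m)%N; last by lia.
rewrite (_ : (c + 2 + m).+1 - c - 2 = m.+1)%N; last by lia.
rewrite k0 addn0; move: (\sum_i d i)%N (\sum_i _)%N => S S1. clear -e0; nia.
Qed.

End NoCurve.

Theorem mainTheorem1 (C : closedFieldType) (hC : is_complex_field C)
    (n c : nat) (d : 'I_c -> nat) (k : nat)
    (hn : (1 <= n)%N) (hc : (1 <= c)%N) (hd : forall i, (1 <= d i)%N)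
    (hnc : (c + 2 <= n)%N)
    (hdeg : (2 * n - c <= \sum_(i < c) d i + k)%N) :
  exists Z : nat -> mpoly C (S_index n c d k) -> Prop,
    (forall j, proper_closed (Z j)) /\
    forall (F : forall i : 'I_c, hform C n.+1 (d i)) (G : hform C n.+1 k),
      smooth_pair F G ->
      (forall j, ~ in_zero_locus (Z j) (S_coords F G)) ->
      forall f : 'I_n.+1 -> {poly C}, ~ A1_curve F G f.
Proof.
have char0 : forall m, (m%:R == 0 :> C) = (m == 0%N) by case: hC => /pcharf0P.
have [Z [Z_proper Z_indep]] := very_general_alg_independent C (S_index n c d k).
exists Z; split=> // F G FG_smooth /Z_indep FG_indep f f_curve.
have [k0|k0] := posnP k.
  exact: (A1_curve_projective_absurd char0 hd hnc hdeg FG_smooth FG_indep f_curve).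
exact: (A1_curve_log_absurd char0 hd hnc hdeg FG_smooth FG_indep f_curve).
Qed.
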